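(* Suppose the system is locally $1$-step reachable: there exists $\gamma>0$ such that for every $x\in\mathcal{X}_\gamma:=\{x\in\mathcal{X}:\|x-x_F\|\le\gamma\}$ there exists $u_x^{\mathrm{one}}\in\mathcal{U}$ with $f(x,u_x^{\mathrm{one}})=x_F$. Assume that the stage cost admits the separable form $r(x,u)=r_x(x)+r_u(u)$, where $r_x$ and $r_u$ are continuous functions satisfying $$r_x(x_F)=0,\quad r_x(x)>0\ \ \forall x\in\mathcal{X}\setminus\{x_F\},\qquad r_u(0)=0,\quad r_u(u)>0\ \ \forall u\in\mathcal{U}\setminus\{0\}.$$ Assume that the following hold: (i) There exists $c>0$ such that $\mathcal{X}_c:=\{x\in\mathcal{X}:\|x-x_F\|\le c\}\subset\mathcal{Q}$, where $$\mathcal{Q}:=\{x\in\mathcal{X}_\gamma:\ \exists\, u_x^{\mathrm{one}}\in\mathcal{U}\text{ such that } f(x,u_x^{\mathrm{one}})=x_F\text{ and } r_x(f(x,u))+r_u(u)\ge r_u(u_x^{\mathrm{one}})\ \ \forall u\in\mathcal{U}\}.$$ (ii) There exists a class $\mathcal{K}$ function $\mathfrak{r}$ such that $r_x(x)\ge\mathfrak{r}(\|x-x_F\|)$ for all $x\in\mathcal{X}\setminus\mathcal{Q}$. Then, for every iteration $j\ge1$ of the DR-RC-Iterative-MPC procedure (defined in the context), with trajectory generated by $\mathrm{DR\_MPC}$, there exists a finite number $\overline{t}\in\mathbb{N}$, $\overline{t}\ge1$, such that $x^j_{\overline{t}}=x_F$.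
   Context: Notation: $\mathbb{N}=\{0,1,2,\dots\}$, $[z]_+=\max(z,0)$, $\|\cdot\|$ is the Euclidean norm. A class $\mathcal{K}$ function is a continuous strictly increasing $\alpha:[0,\infty)\to[0,\infty)$ with $\alpha(0)=0$. For a random variable $Z$ with distribution $\mu$ and $\beta\in(0,1)$, $\mathrm{CVaR}_\beta^{\mu}[Z]=\inf_{s\in\mathbb{R}}\{s+\beta^{-1}\mathbb{E}^{\mu}[Z-s]_+\}$. Problem data. The system is $x_{t+1}=f(x_t,u_t)$ with $f:\mathbb{R}^{n_x}\times\mathbb{R}^{n_u}\to\mathbb{R}^{n_x}$; states and inputs are constrained to compact sets $\mathcal{X}\subset\mathbb{R}^{n_x}$, $\mathcal{U}\subset\mathbb{R}^{n_u}$. $x_S\in\mathcal{X}$ is the initial state and $x_F\in\mathcal{X}$ the target equilibrium, i.e. $0\in\mathcal{U}$ and $f(x_F,0)=x_F$. The stage cost is $r:\mathcal{X}\times\mathcal{U}\to[0,\infty)$. The inequality $r_x(f(x,u))+r_u(u)\ge r_u(u_x^{\mathrm{one}})$ in $\mathcal{Q}$ is understood for inputs $u\in\mathcal{U}$ for which $f(x,u)$ lies in the domain of $r_x$. $w$ is a random variable supported on a compact set $\mathcal{W}\subset\mathbb{R}^{n_w}$; $g:\mathcal{X}\times\mathcal{W}\to\mathbb{R}$ is continuous; $\delta>0$, $\beta\in(0,1)$ and the horizon $K\in\mathbb{N}$, $K\ge1$, are given. Ambiguity sets. $\mathbb{D}$ is a map assigning to each finite dataset of samples from $\mathcal{W}$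 a closed nonempty set of probability distributions supported on $\mathcal{W}$. With $\widehat{\mathcal{W}}^{j}$ the dataset of i.i.d. samples of $w$ available at the end of iteration $j$ (with $\widehat{\mathcal{W}}^{0}$ given initially, and one sample per time-step added during each iteration), set $\mathcal{D}^{j}=\mathbb{D}(\widehat{\mathcal{W}}^{j})$. Sampled-safe-sets. A sampled-safe-set is a finite set $\mathcal{S}\subset\mathbb{N}\times\mathcal{X}\times[0,\infty)$ of triples (trajectory index $i$, state $x$, cost-to-go $J$). $\Pi_{\mathrm{state}}(\mathcal{S})$ is the set of states appearing in it. Its minimum cost-to-go is $Q_{\mathcal{S}}(x)=\min\{J:(i,x,J)\in\mathcal{S}\}$ for $x\in\Pi_{\mathrm{state}}(\mathcal{S})$, and $+\infty$ otherwise. Finite-horizon problem. For a state $x$, sampled-safe-set $\overline{\mathcal{S}}$ and ambiguity set $\overline{\mathcal{D}}$, $\mathrm{FH}(x;\overline{\mathcal{S}},\overline{\mathcal{D}})$ is: minimize $\sum_{k=0}^{K-1}r(x_k,u_k)+Q_{\overline{\mathcal{S}}}(x_K)$ over $(x_0,\dots,x_K)$, $(u_0,\dots,u_{K-1})$ subject to $x_0=x$; $x_{k+1}=f(x_k,u_k)$, $x_k\in\mathcal{X}$, $u_k\in\mathcal{U}$, $\sup_{\mu\in\overline{\mathcal{D}}}\mathrm{CVaR}_\beta^{\mu}[g(x_k,w)]\le\delta$ for all $k=0,\dots,K-1$; and $x_K\in\Pi_{\mathrm{state}}(\overline{\mathcal{S}})$. Whenever it is feasible, the minimum is taken to be attained.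 Routine $\mathrm{DR\_MPC}(\overline{\mathcal{S}},\overline{\mathcal{D}})$: start with $t=0$, $x_0=x_S$. While $x_t\ne x_F$: solve $\mathrm{FH}(x_t;\overline{\mathcal{S}},\overline{\mathcal{D}})$, let $u_t$ be the first input of an optimizer, set $x_{t+1}=f(x_t,u_t)$, and increase $t$ by one. Return the state and input sequences. If $x_F$ is reached, the state stays at $x_F$ with zero input at all later times; if the loop does not terminate, the trajectory is the resulting infinite sequence. DR-RC-Iterative-MPC: for $j=1,2,\dots$: (1) $(\mathsf{x}^j,\mathsf{u}^j)=\mathrm{DR\_MPC}(\mathcal{S}^{j-1},\mathcal{D}^{j-1})$, with states $x_t^j$, inputs $u_t^j$ and length $T_j$; (2) $\widehat{\mathcal{W}}^{j}$ is $\widehat{\mathcal{W}}^{j-1}$ with the $T_j$ new samples added, $\mathcal{D}^j=\mathbb{D}(\widehat{\mathcal{W}}^j)$; (3) form $\tilde{\mathcal{S}}=\mathcal{S}^{j-1}\cup\{(j,x_t^j,J^j_{(t:\infty)})\}_{t=1}^{T_j}$, where $J^j_{(t:\infty)}=\sum_{k=t}^{\infty}r(x_k^j,u_k^j)$; (4) $\mathcal{S}^j$ is obtained from $\tilde{\mathcal{S}}$ by deleting all triples of every trajectory index $i$ for which some $(i,x,J)\in\tilde{\mathcal{S}}$ has $\sup_{\mu\in\mathcal{D}^j}\mathrm{CVaR}_\beta^{\mu}[g(x,w)]>\delta$. Standing assumption: the trajectories of completed iterations (those used to build the sampled-safe-sets) have finite length, ending at $x_F$. Initialization assumption (standing): $\mathcal{S}^0$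 consists of the triples (index $0$, state, cost-to-go) for the states of a finite-length trajectory of the system, generated by inputs in $\mathcal{U}$, that starts at $x_S$ and reaches $x_F$, and is robustly safe: $x\in\mathcal{X}$ and $g(x,w)\le\delta$ for all $w\in\mathcal{W}$ and all $x\in\Pi_{\mathrm{state}}(\mathcal{S}^0)$. *)

(* Defs.v *)
(* MathComp-Analysis, over an arbitrary R : realType. *)
From HB Require Import structures.
From mathcomp Require Import all_boot all_order all_algebra.
From mathcomp Require Import all_classical all_reals all_analysis.

Set Implicit Arguments.
Unset Strict Implicit.
Unset Printing Implicit Defensive.

Import Order.TTheory GRing.Theory Num.Theory.
Import numFieldNormedType.Exports.

Local Open Scope classical_set_scope.
Local Open Scope ring_scope.

(* The library norm of 'rV[R]_n is the sup norm, hence this definition; both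
   induce the topology that [compact], [open], [continuous] refer to. *)
Definition enorm (R : realType) (n : nat) (x : 'rV[R]_n) : R :=
  Num.sqrt (\sum_(i < n) x 0 i ^+ 2).

(* Only the values of [a] on [0, +oo[ matter; they are nonnegative since
   a 0 = 0 and a is increasing. *)
Definition class_K (R : realType) (a : R -> R) : Prop :=
  [/\ {within `[0, +oo[, continuous a},
      {in `[0, +oo[ &, {homo a : s t / s < t}} &
      a 0 = 0].

Definition borel_rV (R : realType) (n : nat) :=
  g_sigma_algebraType (@open 'rV[R]_n).

(* [mu] is meant to be supported on [D], and [Z] need only be meaningful
   there: the expectation is the integral over [D]. *)
Definition CVaR (R : realType) (d : measure_display) (T : measurableType d)
    (D : set T) (beta : R) (mu : probability T R) (Z : T -> R) : \bar R :=
  ereal_inf (range (fun s : R =>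
    s%:E + (beta^-1)%:E * \int[mu]_(w in D) (Num.max (Z w - s) 0)%:E)%E).

(* Closedness, in the set of probability distributions supported on W, for the
   topology of weak convergence: the limit of a convergent filter (equivalently
   net) of elements of A is in A. *)
Definition weakly_closed (R : realType) (n : nat) (W : set (borel_rV R n))
    (A : set (probability (borel_rV R n) R)) : Prop :=
  forall (F : set_system (probability (borel_rV R n) R))
         (mu : probability (borel_rV R n) R),
    ProperFilter F -> F A -> mu W = 1%E ->
    (forall h : 'rV[R]_n -> R, {within (W : set 'rV[R]_n), continuous h} ->
       (fun nu : probability (borel_rV R n) R =>
          (\int[nu]_(w in W) (h w : R))%R) @ F -->
       (\int[mu]_(w in W) (h w : R))%R) ->
    A mu.

(* The maps are total; they are only ever constrained on the relevant sets
   (stage_cost on X * U, constr on X * W, ambiguity on datasets in W). *)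
Record problem (R : realType) (nx nu nw : nat) := Problem {
  dyn : 'rV[R]_nx -> 'rV[R]_nu -> 'rV[R]_nx;
  Xset : set 'rV[R]_nx;
  Uset : set 'rV[R]_nu;
  Wset : set 'rV[R]_nw;
  xS : 'rV[R]_nx;
  xF : 'rV[R]_nx;
  stage_cost : 'rV[R]_nx -> 'rV[R]_nu -> R;
  constr : 'rV[R]_nx -> 'rV[R]_nw -> R;
  delta : R;
  beta : R;
  horizon : nat;
  ambiguity : seq 'rV[R]_nw -> set (probability (borel_rV R nw) R)
}.

(* Triples ((i, x), J): trajectory index, state, cost-to-go. *)
Definition triples (R : realType) (nx : nat) := set (nat * 'rV[R]_nx * R).

Definition sampled_safe_set (R : realType) (nx nu nw : nat)
    (P : problem R nx nu nw) (S : triples R nx) : Prop :=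
  finite_set S /\ forall i x J, S (i, x, J) -> Xset P x /\ 0 <= J.

Definition Pi_state (R : realType) (nx : nat) (S : triples R nx) :
    set 'rV[R]_nx :=
  [set x | exists i J, S (i, x, J)].

(* For a finite S the infimum is a minimum, and it is +oo if x does not appear
   in S. *)
Definition Qmin (R : realType) (nx : nat) (S : triples R nx) (x : 'rV[R]_nx) :
    \bar R :=
  ereal_inf [set J%:E | J in [set J | exists i, S (i, x, J)]].

Definition risk (R : realType) (nx nu nw : nat) (P : problem R nx nu nw)
    (D : set (probability (borel_rV R nw) R)) (x : 'rV[R]_nx) : \bar R :=
  ereal_sup [set CVaR (Wset P : set (borel_rV R nw)) (beta P) mu (constr P x)
            | mu in D].

(* A candidate solution of FH is a pair of sequences of which only
   z.1 0, ..., z.1 K and z.2 0, ..., z.2 (K - 1) are relevant. *)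
Definition FH_feasible (R : realType) (nx nu nw : nat) (P : problem R nx nu nw)
    (x : 'rV[R]_nx) (S : triples R nx)
    (D : set (probability (borel_rV R nw) R))
    (z : (nat -> 'rV[R]_nx) * (nat -> 'rV[R]_nu)) : Prop :=
  [/\ z.1 0%N = x,
      forall k, (k < horizon P)%N ->
        [/\ z.1 k.+1 = dyn P (z.1 k) (z.2 k), Xset P (z.1 k), Uset P (z.2 k) &
            (risk P D (z.1 k) <= (delta P)%:E)%E] &
      Pi_state S (z.1 (horizon P))].

Definition FH_cost (R : realType) (nx nu nw : nat) (P : problem R nx nu nw)
    (S : triples R nx) (z : (nat -> 'rV[R]_nx) * (nat -> 'rV[R]_nu)) : \bar R :=
  ((\sum_(k < horizon P) stage_cost P (z.1 k) (z.2 k))%:E +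
   Qmin S (z.1 (horizon P)))%E.

Definition FH_optimal (R : realType) (nx nu nw : nat) (P : problem R nx nu nw)
    (x : 'rV[R]_nx) (S : triples R nx)
    (D : set (probability (borel_rV R nw) R))
    (z : (nat -> 'rV[R]_nx) * (nat -> 'rV[R]_nu)) : Prop :=
  FH_feasible P x S D z /\
  forall z', FH_feasible P x S D z' -> (FH_cost P S z <= FH_cost P S z')%E.

(* The closed-loop trajectories DR_MPC(S, D) can generate, extended to all
   times: after reaching x_F the state stays there with zero input. FH may have
   several optimizers, hence a relation. If FH has no optimizer at some x_t the
   input u_t is left arbitrary, so that feasibility along the trajectory is not
   presupposed by assuming that (xs, us) was generated by the routine. *)
Definition DR_MPC (R : realType) (nx nu nw : nat) (P : problem R nx nu nw)
    (S : triples R nx) (D : set (probability (borel_rV R nw) R))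
    (xs : nat -> 'rV[R]_nx) (us : nat -> 'rV[R]_nu) : Prop :=
  xs 0%N = xS P /\
  forall t, [/\ xs t.+1 = dyn P (xs t) (us t),
                xs t = xF P -> us t = 0 &
                xs t <> xF P ->
                (exists z, FH_optimal P (xs t) S D z) ->
                exists2 z, FH_optimal P (xs t) S D z & us t = z.2 0%N].

Definition has_length (R : realType) (nx nu nw : nat) (P : problem R nx nu nw)
    (xs : nat -> 'rV[R]_nx) (T : nat) : Prop :=
  xs T = xF P /\ forall t, (t < T)%N -> xs t <> xF P.

Definition cost_to_go (R : realType) (nx nu nw : nat) (P : problem R nx nu nw)
    (xs : nat -> 'rV[R]_nx) (us : nat -> 'rV[R]_nu) (t : nat) : R :=
  limn (fun n => \sum_(t <= k < n) stage_cost P (xs k) (us k)).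

Definition add_trajectory (R : realType) (nx nu nw : nat)
    (P : problem R nx nu nw) (S : triples R nx) (j : nat)
    (xs : nat -> 'rV[R]_nx) (us : nat -> 'rV[R]_nu) (T : nat) : triples R nx :=
  S `|` [set (j, xs t, cost_to_go P xs us t) | t in [set t | (1 <= t <= T)%N]].

Definition remove_unsafe (R : realType) (nx nu nw : nat)
    (P : problem R nx nu nw) (S : triples R nx)
    (D : set (probability (borel_rV R nw) R)) : triples R nx :=
  [set p | S p /\
    ~ exists x J, S (p.1.1, x, J) /\ ((delta P)%:E < risk P D x)%E].

Definition in_W (R : realType) (nx nu nw : nat) (P : problem R nx nu nw)
    (ws : seq 'rV[R]_nw) : Prop :=
  forall w, w \in ws -> Wset P w.

(* [after_iteration P S0 W0 j S ws]: S and ws are possible values of the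
   sampled-safe-set S^j and of the dataset W^j at the end of iteration j. The
   samples collected along the way are arbitrary elements of W, which covers
   every realization of the i.i.d. draws. Completed iterations have finite
   length. *)
Inductive after_iteration (R : realType) (nx nu nw : nat)
    (P : problem R nx nu nw) (S0 : triples R nx) (W0 : seq 'rV[R]_nw) :
    nat -> triples R nx -> seq 'rV[R]_nw -> Prop :=
| after_init : after_iteration P S0 W0 0 S0 W0
| after_next (j : nat) (S : triples R nx) (ws : seq 'rV[R]_nw)
    (xs : nat -> 'rV[R]_nx) (us : nat -> 'rV[R]_nu) (T : nat)
    (new : seq 'rV[R]_nw) :
    after_iteration P S0 W0 j S ws ->
    DR_MPC P S (ambiguity P ws) xs us ->
    has_length P xs T ->
    size new = T ->
    in_W P new ->
    after_iteration P S0 W0 j.+1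
      (remove_unsafe P (add_trajectory P S j.+1 xs us T)
                       (ambiguity P (ws ++ new)))
      (ws ++ new).

(* For j >= 1, (xs, us) is a possible trajectory (x^j, u^j) of iteration j. *)
Definition iteration_trajectory (R : realType) (nx nu nw : nat)
    (P : problem R nx nu nw) (S0 : triples R nx) (W0 : seq 'rV[R]_nw)
    (j : nat) (xs : nat -> 'rV[R]_nx) (us : nat -> 'rV[R]_nu) : Prop :=
  exists S ws, after_iteration P S0 W0 j.-1 S ws /\
               DR_MPC P S (ambiguity P ws) xs us.

Record standing_assumptions (R : realType) (nx nu nw : nat)
    (P : problem R nx nu nw) : Prop := StandingAssumptions {
  compact_X : compact (Xset P);
  compact_U : compact (Uset P);
  compact_W : compact (Wset P);
  xS_in_X : Xset P (xS P);
  xF_in_X : Xset P (xF P);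
  zero_in_U : Uset P 0;
  xF_equilibrium : dyn P (xF P) 0 = xF P;
  stage_cost_ge0 : forall x u, Xset P x -> Uset P u -> 0 <= stage_cost P x u;
  constr_continuous :
    {within Xset P `*` Wset P, continuous (fun p => constr P p.1 p.2)};
  delta_gt0 : 0 < delta P;
  beta_in01 : 0 < beta P < 1;
  horizon_ge1 : (1 <= horizon P)%N;
  ambiguity_nonempty : forall ws, in_W P ws -> ambiguity P ws !=set0;
  ambiguity_supported : forall ws, in_W P ws ->
    forall mu, ambiguity P ws mu -> mu (Wset P : set (borel_rV R nw)) = 1%E;
  ambiguity_closed : forall ws, in_W P ws ->
    weakly_closed (Wset P : set (borel_rV R nw)) (ambiguity P ws);
  FH_min_attained : forall x S ws, sampled_safe_set P S -> in_W P ws ->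
    (exists z, FH_feasible P x S (ambiguity P ws) z) ->
    exists z, FH_optimal P x S (ambiguity P ws) z
}.

(* [T] need not be the first time at which x_F is reached. *)
Definition initial_safe_set (R : realType) (nx nu nw : nat)
    (P : problem R nx nu nw) (S0 : triples R nx) : Prop :=
  (exists xs us T,
    [/\ xs 0%N = xS P,
        forall t, (t < T)%N ->
          Uset P (us t) /\ xs t.+1 = dyn P (xs t) (us t),
        forall t, (T <= t)%N -> xs t = xF P /\ us t = 0 &
        S0 = [set (0%N, xs t, cost_to_go P xs us t)
             | t in [set t | (t <= T)%N]]]) /\
  forall x, Pi_state S0 x ->
    Xset P x /\ forall w, Wset P w -> constr P x w <= delta P.

Definition X_near (R : realType) (nx nu nw : nat) (P : problem R nx nu nw)
    (gamma : R) : set 'rV[R]_nx :=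
  [set x | Xset P x /\ enorm (x - xF P) <= gamma].

Definition Qset (R : realType) (nx nu nw : nat) (P : problem R nx nu nw)
    (rx : 'rV[R]_nx -> R) (ru : 'rV[R]_nu -> R) (gamma : R) : set 'rV[R]_nx :=
  [set x | X_near P gamma x /\
    exists uone, [/\ Uset P uone, dyn P x uone = xF P &
      forall u, Uset P u -> Xset P (dyn P x u) ->
        ru uone <= rx (dyn P x u) + ru u]].

(* Main.v *)
Require Import Defs.
From HB Require Import structures.
From mathcomp Require Import all_boot all_order all_algebra.
From mathcomp Require Import all_classical all_reals all_analysis.
From mathcomp Require Import lra.

Set Implicit Arguments.
Unset Strict Implicit.
Unset Printing Implicit Defensive.

Import Order.TTheory GRing.Theory Num.Theory.
Import numFieldNormedType.Exports.

Local Open Scope classical_set_scope.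
Local Open Scope ring_scope.

(** The closed loop reaches [x_F] because the optimal cost [V] of the
    finite-horizon problem is a Lyapunov function that cannot stay positive.

    Everything rests on an invariant of the sampled-safe-set [S] and the
    ambiguity set [D] in force during an iteration, the record [certified]:
    every stored state is safe for [D]; every stored triple has a successor in
    [S] whose cost-to-go is smaller by exactly one stage cost; [S] contains
    [x_S], and [x_F] with cost-to-go 0.  It holds at every iteration
    ([after_iteration_certified]): deletion works on whole trajectories, so it
    respects successors, and the initial trajectory is never deleted since a
    pointwise constraint [g(x, w) <= delta] bounds every CVaR by [delta].

    Under this invariant an optimal plan at [x_t] can be shifted by one step
    and prolonged by the stored successor of its last state.  Hence the problem
    stays feasible along the closed loop ([closed_loop_optimum]) and
    [r(x_t, u_t) + V(x_(t+1)) <= V(x_t)] ([value_decrease]).  As [V >= 0], some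
    stage cost is arbitrarily small ([small_stage_cost]) unless [x_F] is
    reached; the class K lower bound on [r_x] outside [Q] then forces some [x_t]
    to lie in [Q].

    At such an [x_t] let [u1] be the input given by membership in [Q], which
    leads to [x_F] in one step.  Moving to [x_F] with [u1] and resting there is
    a feasible plan, so [V(x_t) <= r_x(x_t) + r_u(u1)] ([value_one_step]), and
    [r_u(u1) <= r_x(x_(t+1)) + r_u(u_t)] by definition of [Q].  The decrease of
    [V] gives [V(x_(t+1)) <= r_x(x_(t+1))], and once more [V(x_(t+2)) <= 0].
    Since [V(x_(t+2)) >= r_x(x_(t+2))], the state [x_(t+2)] is [x_F]. *)

(** * Minimum cost-to-go and risk *)

Lemma finite_set_min (R : realType) (A : set R) :
  finite_set A -> A !=set0 -> exists2 m, A m & forall y, A y -> m <= y.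
Proof.
move=> /finite_seqP[s ->] {A}; elim: s => [[x]//|a s IH _].
have [->|sN0] := eqVneq s [::].
  by exists a; rewrite /= ?mem_head// => y /=; rewrite inE => /eqP ->.
have [|m ms mP] := IH.
  by case: s sN0 {IH} => // b s _; exists b; rewrite /= mem_head.
have [am|ma] := leP a m.
  exists a => [|y /=]; first by rewrite /= mem_head.
  by rewrite inE => /predU1P[->//|/mP]; exact: le_trans.
exists m => [|y /=]; first by rewrite /= inE; apply/orP; right.
by rewrite inE => /predU1P[->|/mP//]; exact: ltW.
Qed.

Lemma Qmin_attained (R : realType) (nx : nat) (S : triples R nx) x :
  finite_set S -> Pi_state S x -> exists i J, S (i, x, J) /\ Qmin S x = J%:E.
Proof.
move=> finS [i0 [J0 SJ0]].
have [||J [i SJ] Jmin] := @finite_set_min R [set J | exists i, S (i, x, J)].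
- apply: (@sub_finite_set _ _ (snd @` S)); last exact: finite_image.
  by move=> J /= [i SJ]; exists (i, x, J).
- by exists J0, i0.
exists i, J; split=> //; apply/eqP; rewrite eq_le; apply/andP; split.
  by apply: ereal_inf_lbound; exists J => //; exists i.
by apply: le_ereal_inf_tmp => _ [J' SJ' <-]; rewrite lee_fin; exact: Jmin.
Qed.

(** The value [delta] of the CVaR parameter [s] makes the integrand
    [max (g(x, w) - s) 0] vanish on the support, whatever the distribution. *)
Lemma risk_le_delta (R : realType) (nx nu nw : nat) (P : problem R nx nu nw)
    (D : set (probability (borel_rV R nw) R)) x :
  (forall w, Wset P w -> constr P x w <= delta P) ->
  (risk P D x <= (delta P)%:E)%E.
Proof.
move=> xsafe; apply: ge_ereal_sup => _ [mu _ <-].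
apply: ge_ereal_inf; eexists; first by exists (delta P).
rewrite integral0_eq ?mule0 ?adde0// => w /xsafe gle.
by congr (_%:E); apply/max_idPr; rewrite subr_le0.
Qed.

(** * Trajectories that reach the target *)

Section SafeSets.
Variables (R : realType) (nx nu nw : nat) (P : problem R nx nu nw).
Hypothesis hP : standing_assumptions P.
(* In the separable case this is [r_x(x_F) + r_u(0)]. *)
Hypothesis cost_xF : stage_cost P (xF P) 0 = 0.

Local Notation plan := ((nat -> 'rV[R]_nx) * (nat -> 'rV[R]_nu))%type.
Local Notation ambiguity_set := (set (probability (borel_rV R nw) R)).

(** [T] may be any time from which the trajectory rests at the target, not
    just the first one, so that both the initial trajectory and the recorded
    closed-loop ones are covered. *)
Record completed (xs : nat -> 'rV[R]_nx) (us : nat -> 'rV[R]_nu) (T : nat) :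
    Prop := Completed {
  completed_dyn : forall t, xs t.+1 = dyn P (xs t) (us t);
  completed_X : forall t, Xset P (xs t);
  completed_U : forall t, Uset P (us t);
  completed_end : forall t, (T <= t)%N -> xs t = xF P /\ us t = 0
}.

Section CompletedTrajectory.
Variables (xs : nat -> 'rV[R]_nx) (us : nat -> 'rV[R]_nu) (T : nat).
Hypothesis done : completed xs us T.

(** Stage costs vanish from time [T] on, so the limit of partial sums is a
    finite sum; the bound [maxn t T] makes it empty when [T <= t]. *)
Lemma cost_to_goE t :
  cost_to_go P xs us t = \sum_(t <= k < maxn t T) stage_cost P (xs k) (us k).
Proof.
rewrite /cost_to_go; apply: lim_near_cst => //; exists (maxn t T) => // n /= Tn.
rewrite (big_cat_nat (n := maxn t T)) ?leq_maxl//=.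
rewrite [X in _ + X = _]big_nat_cond [X in _ + X = _]big1 ?addr0// => k.
rewrite andbT => /andP[kT _].
have [|-> ->] := completed_end done (t := k) => //.
by rewrite (leq_trans _ kT)// leq_maxr.
Qed.

Lemma cost_to_go_ge0 t : 0 <= cost_to_go P xs us t.
Proof.
rewrite cost_to_goE; apply: sumr_ge0 => k _.
apply: (stage_cost_ge0 hP); first exact: completed_X done k.
exact: completed_U done k.
Qed.

Lemma cost_to_go_end t : (T <= t)%N -> cost_to_go P xs us t = 0.
Proof. by move=> /maxn_idPl Tt; rewrite cost_to_goE Tt big_geq. Qed.

Lemma cost_to_go_step t :
  cost_to_go P xs us t = stage_cost P (xs t) (us t) + cost_to_go P xs us t.+1.
Proof.
have [Tt|tT] := leqP T t.
  have [-> ->] := completed_end done Tt.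
  by rewrite !cost_to_go_end ?cost_xF ?addr0// ltnW.
by rewrite !cost_to_goE (maxn_idPr (ltnW tT)) (maxn_idPr tT) big_ltn.
Qed.

End CompletedTrajectory.

(** * Certified sampled-safe-sets *)

Definition successor_closed (S : triples R nx) : Prop :=
  forall i x J, S (i, x, J) -> exists u J',
    [/\ Uset P u, S (i, dyn P x u, J') & J = stage_cost P x u + J'].

(** The starting time [m] is 0 for the initial trajectory and 1 for the later
    ones, whose state at time 0 is not recorded. *)
Definition trajectory_triples (i m : nat) xs us T : triples R nx :=
  [set (i, xs t, cost_to_go P xs us t) | t in [set t | (m <= t <= T)%N]].

Lemma trajectory_triples_sampled i m xs us T : completed xs us T ->
  sampled_safe_set P (trajectory_triples i m xs us T).
Proof.
move=> done; split.
  apply: finite_image; apply: (@sub_finite_set _ _ `I_T.+1) => // t /=.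
  by case/andP.
move=> _ _ _ [t _ [_ <- <-]]; split; first exact: completed_X done t.
exact: cost_to_go_ge0 done t.
Qed.

(** The last recorded triple [(i, x_F, 0)] is its own successor, under the zero
    input. *)
Lemma trajectory_triples_closed i m xs us T : completed xs us T ->
  successor_closed (trajectory_triples i m xs us T).
Proof.
move=> done _ _ _ [t /andP[mt tT] [<- <- <-]].
exists (us t), (cost_to_go P xs us t.+1); split.
- exact: completed_U done t.
- have [tlt|tge] := ltnP t T.
    by exists t.+1; rewrite /= ?(completed_dyn done)// tlt leqW.
  exists t; rewrite /= ?mt ?tT//; congr (_, _, _).
    rewrite -(completed_dyn done).
    have [-> _] := completed_end done tge.
    by have [-> _] := completed_end done (leqW tge).
  by rewrite !(cost_to_go_end done)// leqW.
- exact: cost_to_go_step done t.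
Qed.

(** The invariant that makes the finite-horizon problem recursively feasible
    and its optimal cost decrease along the closed loop. *)
Record certified (S : triples R nx) (D : ambiguity_set) : Prop := Certified {
  cert_sampled : sampled_safe_set P S;
  cert_closed : successor_closed S;
  cert_safe : forall x, Pi_state S x -> (risk P D x <= (delta P)%:E)%E;
  cert_start : Pi_state S (xS P);
  cert_target : exists i, S (i, xF P, 0)
}.

(** * Plans and their prolongation *)

(** [FH_feasible] with an arbitrary horizon, to which it is convertible when
    [n] is the horizon; prolonging a plan goes through length [n.+1]. *)
Definition admissible (n : nat) x (S : triples R nx) (D : ambiguity_set)
    (z : plan) : Prop :=
  [/\ z.1 0%N = x,
      forall k, (k < n)%N ->
        [/\ z.1 k.+1 = dyn P (z.1 k) (z.2 k), Xset P (z.1 k), Uset P (z.2 k) &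
            (risk P D (z.1 k) <= (delta P)%:E)%E] &
      Pi_state S (z.1 n)].

Definition path_cost (n : nat) (z : plan) : R :=
  \sum_(k < n) stage_cost P (z.1 k) (z.2 k).

Definition shift (z : plan) : plan := (fun k => z.1 k.+1, fun k => z.2 k.+1).

(** The plan [z] of length [n], followed by one step with input [u]. *)
Definition append (n : nat) (z : plan) (u : 'rV[R]_nu) : plan :=
  (fun k => if (k <= n)%N then z.1 k else dyn P (z.1 n) u,
   fun k => if (k < n)%N then z.2 k else u).

Lemma path_cost_shift n z :
  path_cost n.+1 z = stage_cost P (z.1 0%N) (z.2 0%N) + path_cost n (shift z).
Proof. by rewrite /path_cost big_ord_recl. Qed.

Lemma path_cost_append n z u :
  path_cost n.+1 (append n z u) = path_cost n z + stage_cost P (z.1 n) u.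
Proof.
rewrite /path_cost big_ord_recr /= leqnn ltnn; congr (_ + _).
by apply: eq_bigr => k _; rewrite ltn_ord ltnW.
Qed.

Lemma path_cost_ge0 n x S D z : admissible n x S D z -> 0 <= path_cost n z.
Proof.
move=> [_ hz _]; apply: sumr_ge0 => k _.
by have [_ ? ? _] := hz k (ltn_ord k); exact: stage_cost_ge0.
Qed.

Lemma admissible_shift n x S D z :
  admissible n.+1 x S D z -> admissible n (z.1 1%N) S D (shift z).
Proof. by move=> [_ hz hn]; split=> // k kn; exact: hz. Qed.

Lemma admissible_append n x S D z u : certified S D ->
  admissible n x S D z -> Uset P u -> Pi_state S (dyn P (z.1 n) u) ->
  admissible n.+1 x S D (append n z u).
Proof.
move=> cert [z0 hz hn] Uu Su; split => //=; last by rewrite ltnn.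
move=> k; rewrite ltnS leq_eqVlt => /predU1P[->|kn]; last first.
  by rewrite kn orbT; exact: hz.
rewrite eqxx !ltnn; split=> //; last exact: cert_safe cert _ hn.
by have [i [J /(cert_sampled cert).2[]]] := hn.
Qed.

(** From a stored state, following stored successors is a safe plan of any
    length. *)
Lemma admissible_from_safe_set n x S D : certified S D -> Pi_state S x ->
  exists z, admissible n x S D z.
Proof.
move=> cert Sx; elim: n => [|n [z hz]].
  by exists (fun=> x, fun=> 0).
have [_ _ [i [J /(cert_closed cert)[u [J' [Uu SJ' _]]]]]] := hz.
by exists (append n z u); apply: admissible_append => //; exists i, J'.
Qed.

(** * The optimal cost of the finite-horizon problem *)

(** The infimum makes the optimal cost independent of the optimizer; [fine] is
    harmless when an optimizer exists, by [opt_costE]. *)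
Definition opt_cost x (S : triples R nx) (D : ambiguity_set) : R :=
  fine (ereal_inf [set FH_cost P S z | z in FH_feasible P x S D]).

Section OptimalCost.
Variables (S : triples R nx) (D : ambiguity_set).
Hypothesis cert : certified S D.

Lemma opt_costE x z : FH_optimal P x S D z ->
  (opt_cost x S D)%:E = FH_cost P S z.
Proof.
move=> [feas opt]; rewrite /opt_cost.
have -> : ereal_inf [set FH_cost P S z | z in FH_feasible P x S D] =
          FH_cost P S z.
  apply/eqP; rewrite eq_le; apply/andP; split.
    by apply: ereal_inf_lbound; exists z.
  by apply: le_ereal_inf_tmp => _ [z' feas' <-]; exact: opt.
have [_ _ /(Qmin_attained (cert_sampled cert).1)[i [J [_ QJ]]]] := feas.
by rewrite /FH_cost QJ.
Qed.

Lemma opt_cost_attained x z : FH_optimal P x S D z ->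
  exists i J, S (i, z.1 (horizon P), J) /\
              opt_cost x S D = path_cost (horizon P) z + J.
Proof.
move=> opt; have [_ _ /(Qmin_attained (cert_sampled cert).1)] := opt.1.
move=> [i [J [SJ QJ]]]; exists i, J; split=> //; apply: EFin_inj.
by rewrite (opt_costE opt) /FH_cost QJ.
Qed.

Lemma opt_cost_le x z z' i J : FH_optimal P x S D z ->
  FH_feasible P x S D z' -> S (i, z'.1 (horizon P), J) ->
  opt_cost x S D <= path_cost (horizon P) z' + J.
Proof.
move=> opt feas' SJ; rewrite -lee_fin (opt_costE opt).
apply: (le_trans (opt.2 _ feas')); rewrite EFinD leeD2l//.
by apply: ereal_inf_lbound; exists J => //; exists i.
Qed.

Lemma opt_cost_ge0 x z : FH_optimal P x S D z -> 0 <= opt_cost x S D.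
Proof.
move=> opt; have [i [J [/(cert_sampled cert).2[_ J0] ->]]] :=
  opt_cost_attained opt.
by rewrite addr_ge0// (path_cost_ge0 opt.1).
Qed.

(** The plan obtained from an optimizer [z] by dropping its first step and
    appending the stored successor of its last state costs exactly one stage
    cost less: the cost-to-go of the last state pays for the appended step. *)
Lemma shifted_plan x z : FH_optimal P x S D z ->
  exists z' i J, [/\ FH_feasible P (dyn P x (z.2 0%N)) S D z',
    S (i, z'.1 (horizon P), J) &
    stage_cost P x (z.2 0%N) + (path_cost (horizon P) z' + J) =
    opt_cost x S D].
Proof.
move=> opt; have [z0 hz _] := opt.1; have K1 := horizon_ge1 hP.
have [i [J [SJ ->]]] := opt_cost_attained opt.
have [u [J' [Uu SJ' ->]]] := cert_closed cert SJ.
have adm : admissible (horizon P).+1 x S D (append (horizon P) z u).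
  by apply: admissible_append opt.1 Uu _ => //; exists i, J'.
exists (shift (append (horizon P) z u)), i, J'; split.
- have := admissible_shift adm; rewrite /= K1.
  by have [-> _ _ _] := hz 0%N K1; rewrite z0.
- by rewrite /= ltnn.
have := path_cost_shift (horizon P) (append (horizon P) z u).
rewrite path_cost_append /= K1 z0 => e.
by rewrite !addrA -e -!addrA.
Qed.

Lemma opt_cost_decrease x z z' : FH_optimal P x S D z ->
  FH_optimal P (dyn P x (z.2 0%N)) S D z' ->
  stage_cost P x (z.2 0%N) + opt_cost (dyn P x (z.2 0%N)) S D <=
  opt_cost x S D.
Proof.
move=> opt opt'; have [w [i [J [feas SJ <-]]]] := shifted_plan opt.
by rewrite lerD2l; exact: opt_cost_le opt' feas SJ.
Qed.

(** Moving to [x_F] in one step and resting there is feasible: the state [x]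
    is safe because some optimizer starts from it. *)
Lemma opt_cost_one_step x z u : FH_optimal P x S D z ->
  Uset P u -> dyn P x u = xF P -> opt_cost x S D <= stage_cost P x u.
Proof.
move=> opt Uu fu; have [i Si] := cert_target cert.
have [z0 /(_ _ (horizon_ge1 hP))[_ Xx _ safex] _] := opt.1.
rewrite z0 in Xx safex.
pose one_step : plan := (fun k => if k is 0 then x else xF P,
                         fun k => if k is 0 then u else 0).
have [K hK] : exists K, horizon P = K.+1.
  by exists (horizon P).-1; rewrite prednK// (horizon_ge1 hP).
have -> : stage_cost P x u = path_cost (horizon P) one_step + 0.
  rewrite hK path_cost_shift addr0 [path_cost K _]big1 ?addr0// => k _ /=.
apply: (opt_cost_le (i := i) opt); last by rewrite hK.
split; [by []| |by rewrite hK; exists i, 0].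
have safeF : (risk P D (xF P) <= (delta P)%:E)%E.
  by apply: (cert_safe cert); exists i, 0.
have [[XF U0] fF] := (xF_in_X hP, zero_in_U hP, xF_equilibrium hP).
case=> [|k] _; first exact (And4 (esym fu) Xx Uu safex).
exact (And4 (esym fF) XF U0 safeF).
Qed.

End OptimalCost.

(** * The closed loop *)

Section ClosedLoop.
Variables (S : triples R nx) (ws : seq 'rV[R]_nw).
Variables (xs : nat -> 'rV[R]_nx) (us : nat -> 'rV[R]_nu).
Hypothesis cert : certified S (ambiguity P ws).
Hypothesis ws_in_W : in_W P ws.
Hypothesis mpc : DR_MPC P S (ambiguity P ws) xs us.

Lemma optimum_of_feasible x :
  (exists z, FH_feasible P x S (ambiguity P ws) z) ->
  exists z, FH_optimal P x S (ambiguity P ws) z.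
Proof. by apply: (FH_min_attained hP) => //; exact: cert_sampled cert. Qed.

(** Recursive feasibility: the initial state is stored in [S], and afterwards
    the shifted plan is available. *)
Lemma closed_loop_optimum t :
  exists z, FH_optimal P (xs t) S (ambiguity P ws) z.
Proof.
have [x0 step] := mpc; elim: t => [|t IH]; apply: optimum_of_feasible.
  by rewrite x0; exact: admissible_from_safe_set cert (cert_start cert).
have [-> u0 umpc] := step t.
have [xF_t|xNF] := pselect (xs t = xF P).
  rewrite u0 // xF_t (xF_equilibrium hP).
  apply: (admissible_from_safe_set _ cert).
  by have [i Si] := cert_target cert; exists i, 0.
have [z opt ->] := umpc xNF IH.
by have [z' [i [J [? _ _]]]] := shifted_plan cert opt; exists z'.
Qed.

Lemma closed_loop_X t : Xset P (xs t).
Proof.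
have [z [[z0 /(_ _ (horizon_ge1 hP))[_ + _ _] _] _]] := closed_loop_optimum t.
by rewrite z0.
Qed.

Lemma closed_loop_U t : Uset P (us t).
Proof.
have [_ u0 umpc] := mpc.2 t.
have [xF_t|xNF] := pselect (xs t = xF P).
  by rewrite u0 //; exact: zero_in_U.
have [z [[_ /(_ _ (horizon_ge1 hP))[_ _ Uz _] _] _] ->] :=
  umpc xNF (closed_loop_optimum t).
exact: Uz.
Qed.

Lemma closed_loop_stays T t :
  xs T = xF P -> (T <= t)%N -> xs t = xF P /\ us t = 0.
Proof.
move=> xT /subnKC <-; elim: (t - T)%N => [|n [xn un]].
  by rewrite addn0; split=> //; have [_ /(_ xT)] := mpc.2 T.
have [xS' _ _] := mpc.2 (T + n)%N.
have x' : xs (T + n.+1)%N = xF P.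
  by rewrite addnS xS' xn un (xF_equilibrium hP).
by split=> //; have [_ /(_ x')] := mpc.2 (T + n.+1)%N.
Qed.

Lemma closed_loop_completed T : xs T = xF P -> completed xs us T.
Proof.
move=> xT; split; [|exact: closed_loop_X|exact: closed_loop_U|].
  by move=> t; have [] := mpc.2 t.
by move=> t; exact: closed_loop_stays.
Qed.

Lemma closed_loop_input t : xs t <> xF P ->
  exists2 z, FH_optimal P (xs t) S (ambiguity P ws) z & us t = z.2 0%N.
Proof.
by move=> xNF; have [_ _ /(_ xNF (closed_loop_optimum t))] := mpc.2 t.
Qed.

Local Notation value t := (opt_cost (xs t) S (ambiguity P ws)).

Lemma value_ge0 t : 0 <= value t.
Proof. by have [z opt] := closed_loop_optimum t; exact: opt_cost_ge0 opt. Qed.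

Lemma value_decrease t : xs t <> xF P ->
  stage_cost P (xs t) (us t) + value t.+1 <= value t.
Proof.
move=> /closed_loop_input[z opt uz].
have [z' opt'] := closed_loop_optimum t.+1.
have [xS' _ _] := mpc.2 t; move: opt'; rewrite xS' uz.
exact: opt_cost_decrease.
Qed.

Lemma value_one_step t u : Uset P u -> dyn P (xs t) u = xF P ->
  value t <= stage_cost P (xs t) u.
Proof.
by have [z opt] := closed_loop_optimum t; exact: opt_cost_one_step opt.
Qed.

(** Otherwise the nonnegative value would drop by at least [e] at every
    step. *)
Lemma small_stage_cost (e : R) : 0 < e -> (forall t, xs t <> xF P) ->
  exists t, stage_cost P (xs t) (us t) < e.
Proof.
move=> e0 xNF; apply/not_existsP => big.
have lin n : value n + e *+ n <= value 0%N.
  elim: n => [|n IH]; first by rewrite mulr0n addr0.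
  apply: le_trans IH; rewrite mulrS addrA lerD2r addrC.
  apply: le_trans (value_decrease (xNF n)); rewrite lerD2r leNgt.
  exact/negP/big.
pose N := Num.bound (value 0%N / e).
have : value 0%N < e *+ N.
  rewrite -mulr_natl -ltr_pdivrMr// archi_boundP// divr_ge0 ?(ltW e0)//.
  exact: value_ge0.
by move/(le_lt_trans (lin N)); rewrite gtrDr ltNge value_ge0.
Qed.

End ClosedLoop.

Lemma initial_safe_set_completed S0 : initial_safe_set P S0 ->
  exists xs us T, [/\ completed xs us T, xs 0%N = xS P &
    S0 = trajectory_triples 0 0 xs us T].
Proof.
move=> [[xs [us [T [x0 step tail eS0]]]] safe].
exists xs, us, T; split=> //; split=> t.
- have [/step[]//|/[dup]/tail[-> ->] Tt] := ltnP t T.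
  by rewrite (xF_equilibrium hP); have [] := tail _ (leqW Tt).
- have [tT|/ltnW/tail[-> _]] := leqP t T; last exact: xF_in_X.
  apply: (safe _ _).1; exists 0%N, (cost_to_go P xs us t).
  by rewrite eS0; exists t.
- by have [/step[]//|/tail[_ ->]] := ltnP t T; exact: zero_in_U.
- exact: tail.
Qed.

(** The initial trajectory alone provides the stored states [x_S] and
    [x_F]. *)
Lemma certified_of_supset S0 S D : initial_safe_set P S0 ->
  S0 `<=` S -> sampled_safe_set P S -> successor_closed S ->
  (forall x, Pi_state S x -> (risk P D x <= (delta P)%:E)%E) ->
  certified S D.
Proof.
move=> /initial_safe_set_completed[xs [us [T [done x0 ->]]]] sub sam clo safe.
split=> //.
  by exists 0%N, (cost_to_go P xs us 0); apply: sub; exists 0%N; rewrite //= x0.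
exists 0%N; apply: sub; exists T => /=; first by rewrite leqnn.
by rewrite (cost_to_go_end done)//; have [-> _] := completed_end done (leqnn T).
Qed.

(** * The invariant along the iterations *)

Section Iterations.
Variables (S0 : triples R nx) (W0 : seq 'rV[R]_nw).
Hypothesis hS0 : initial_safe_set P S0.
Hypothesis hW0 : in_W P W0.

(** The induction also carries that index 0 is borne only by the initial,
    robustly safe, states, since one unsafe triple of index 0 would delete the
    whole initial trajectory. *)
Lemma after_iteration_certified j S ws : after_iteration P S0 W0 j S ws ->
  [/\ in_W P ws, S0 `<=` S, forall x J, S (0%N, x, J) -> Pi_state S0 x &
      certified S (ambiguity P ws)].
Proof.
elim=> [|{}j {}S {}ws xs us T new _ [wsW sub zero cert] mpc [xT _] _ newW].
  split=> //; first by move=> x J SJ; exists 0%N, J.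
  have [xs [us [T [done _ eS0]]]] := initial_safe_set_completed hS0.
  apply: (certified_of_supset hS0) => //.
  - by rewrite eS0; exact: trajectory_triples_sampled.
  - by rewrite eS0; exact: trajectory_triples_closed.
  - by move=> x /hS0.2[_]; exact: risk_le_delta.
have done := closed_loop_completed cert wsW mpc xT.
have zero' x J : add_trajectory P S j.+1 xs us T (0%N, x, J) -> Pi_state S0 x.
  by case=> [/zero//|[t _ [//]]].
have [finN smpN] := trajectory_triples_sampled j.+1 1 done.
have [finS smpS] := cert_sampled cert.
have idx0 x : S0 x -> x.1.1 = 0%N.
  have [ys [vs [T' [_ _ ->]]]] := initial_safe_set_completed hS0.
  by case=> t _ <-.
(* The initial trajectory survives the deletion. *)
have sub' : S0 `<=` remove_unsafe P (add_trajectory P S j.+1 xs us T)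
                     (ambiguity P (ws ++ new)).
  move=> p S0p; split; first by left; exact: sub.
  move=> [x [J []]]; rewrite (idx0 _ S0p) => /zero' /hS0.2[_ xsafe].
  by rewrite ltNge risk_le_delta.
split=> //.
- by move=> w; rewrite mem_cat => /orP[/wsW|/newW].
- by move=> x J [/zero'].
apply: (certified_of_supset hS0) => //.
- split; last by move=> i x J [[/smpS|/smpN]].
  apply: (@sub_finite_set _ _ (S `|` trajectory_triples j.+1 1 xs us T)).
    by move=> p [].
  by rewrite finite_setU.
- move=> i x J [Sp safe].
  (* Deletion depends on the index only, which a successor shares, so it is
     enough to find the successor before the deletion. *)
  suff [u [J' [Uu SJ' eJ]]] : exists u J', [/\ Uset P u,
      add_trajectory P S j.+1 xs us T (i, dyn P x u, J') &
      J = stage_cost P x u + J'].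
    by exists u, J'; split.
  case: Sp => [/(cert_closed cert)|/(trajectory_triples_closed done)].
    by move=> [u [J' [? ? ?]]]; exists u, J'; split=> //; left.
  by move=> [u [J' [? ? ?]]]; exists u, J'; split=> //; right.
move=> x [i [J [Sp safe]]]; rewrite leNgt; apply/negP => unsafe.
by apply: safe; exists x, J.
Qed.

End Iterations.
End SafeSets.

(** * Finite-time convergence *)

Theorem mainTheorem5 (R : realType) (nx nu nw : nat) (P : problem R nx nu nw)
    (S0 : triples R nx) (W0 : seq 'rV[R]_nw)
    (rx : 'rV[R]_nx -> R) (ru : 'rV[R]_nu -> R) (gamma : R)
    (hP : standing_assumptions P)
    (hS0 : initial_safe_set P S0)
    (hW0 : in_W P W0)
    (hgamma : 0 < gamma)
    (hreach : forall x, X_near P gamma x ->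
       exists2 u, Uset P u & dyn P x u = xF P)
    (hsep : forall x u, Xset P x -> Uset P u -> stage_cost P x u = rx x + ru u)
    (hrx : {within Xset P, continuous rx})
    (hru : {within Uset P, continuous ru})
    (hrxF : rx (xF P) = 0)
    (hrx_gt0 : forall x, Xset P x -> x <> xF P -> 0 < rx x)
    (hru0 : ru 0 = 0)
    (hru_gt0 : forall u, Uset P u -> u <> 0 -> 0 < ru u)
    (hQ : exists2 c, 0 < c & X_near P c `<=` Qset P rx ru gamma)
    (hK : exists2 a : R -> R, class_K a &
       forall x, Xset P x -> ~ Qset P rx ru gamma x ->
         a (enorm (x - xF P)) <= rx x) :
  forall (j : nat) (xs : nat -> 'rV[R]_nx) (us : nat -> 'rV[R]_nu),
    (1 <= j)%N ->
    iteration_trajectory P S0 W0 j xs us ->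
    exists2 tbar : nat, (1 <= tbar)%N & xs tbar = xF P.
Proof.
move=> [|j] xs us // _ [S [ws [/= after mpc]]].
have cost_xF : stage_cost P (xF P) 0 = 0.
  by rewrite hsep ?hrxF ?hru0 ?addr0//; [exact: xF_in_X | exact: zero_in_U].
have [wsW _ _ cert] := after_iteration_certified hP cost_xF hS0 hW0 after.
have inX := closed_loop_X hP cert wsW mpc.
have inU := closed_loop_U hP cert wsW mpc.
have ru_ge0 u : Uset P u -> 0 <= ru u.
  move=> Uu; have [->|/eqP/hru_gt0] := eqVneq u 0; first by rewrite hru0.
  by move=> /(_ Uu)/ltW.
apply: contrapT => never.
have xNF t : xs t <> xF P.
  move=> xt; apply: never; exists t.+1 => //.
  by have [] := closed_loop_stays hP mpc xt (leqnSn t).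
have [c c0 cQ] := hQ; have [a [_ a_incr a0] aQ] := hK.
have a_gt0 s : 0 < s -> 0 < a s.
  move=> s0; rewrite -[ltLHS]a0.
  by apply: a_incr; rewrite ?in_itv/= ?andbT// ltW.
have [t] := small_stage_cost hP cert wsW mpc (a_gt0 _ c0) xNF.
rewrite hsep// => small.
(* Outside Q the state would be further than [c] from the target, where
   [r_x >= a c]. *)
have Qxt : Qset P rx ru gamma (xs t).
  apply: contrapT => nQ; have far : c < enorm (xs t - xF P).
    by rewrite ltNge; apply/negP => le_c; apply: nQ; exact: cQ.
  have lt_a : a c < a (enorm (xs t - xF P)).
    have far0 := lt_trans c0 far.
    by apply: a_incr => //; rewrite in_itv/= andbT ltW.
  have := aQ _ (inX t) nQ; have := ru_ge0 _ (inU t); lra.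
have [_ [uone [Uone reach cheap]]] := Qxt.
have [xt1 _ _] := mpc.2 t.
have {cheap} := cheap (us t) (inU t); rewrite -xt1 => /(_ (inX _)) cheap.
(* V0, V1 and the choice of [uone] bound the value at [t.+1] by
   [rx (xs t.+1)]; V2 makes the value at [t.+2] nonpositive; V3 and V4 bound it
   below by [rx (xs t.+2) > 0]. *)
have V0 := value_one_step hP cost_xF cert wsW mpc Uone reach.
have V1 := value_decrease hP cert wsW mpc (xNF t).
have V2 := value_decrease hP cert wsW mpc (xNF t.+1).
have V3 := value_decrease hP cert wsW mpc (xNF t.+2).
have V4 := value_ge0 hP cert wsW mpc t.+3.
have r2 := hrx_gt0 _ (inX t.+2) (xNF t.+2).
have u1 := ru_ge0 _ (inU t.+1).
have u2 := ru_ge0 _ (inU t.+2).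
move: V0 V1 V2 V3; rewrite !hsep//; lra.
Qed.
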